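(* Let $\mu$ be a regular Borel probability measure on $\mathbb{S}^{d-1}$ whose support $G$ satisfies: (C1) the open half-spaces $H_u$ with $u\in G$ cover $\mathbb{S}^{d-1}$, and (C2) the reflections $\{R_u\mid u\in G\}$ generate a dense subgroup of $O(d)$. Let $\rho$ be the unique regular Borel probability measure on $\mathbb{S}^{d-1}$ such that $\rho(A)=\int_{\mathbb{S}^{d-1}}\rho(F_u^{-1}(A))\,d\mu(u)$ for all Borel sets $A$. Let $(U_n)_{n\ge1}$ be i.i.d. random directions with distribution $\mu$, and for a starting point $x\in\mathbb{S}^{d-1}$ let $X_0=x$, $X_n=F_{U_n}(X_{n-1})$ for $n\ge 1$. Then for every Borel set $A\subset\mathbb{S}^{d-1}$, $$\lim_{N\to\infty}\frac1N\left|\{\,1\le n\le N\mid X_n\in A\}\right|=\rho(A)$$ almost surely, for $\rho$-almost every starting point $x\in\mathbb{S}^{d-1}$.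
   Context: $\mathbb{S}^{d-1}$ is the set of unit vectors in $\mathbb{R}^d$; $O(d)$ is the group of orthogonal linear transformations of $\mathbb{R}^d$. For $u\in\mathbb{S}^{d-1}$: $R_u x=x-2(x\cdot u)u$; $H_u=\{x\in\mathbb{R}^d\mid x\cdot u>0\}$; the folding map is $F_u(x)=x$ if $x\in H_u$ and $F_u(x)=R_ux$ otherwise, regarded as a map of $\mathbb{S}^{d-1}$ to itself. The support of a measure is the smallest closed subset of full measure. Existence and uniqueness of $\rho$ under these hypotheses is a theorem of the same paper and may be assumed. *)

(* Defs.v *)
From HB Require Import structures.
From mathcomp Require Import all_boot all_order all_algebra.
From mathcomp Require Import finmap ring.
From mathcomp Require Import all_classical all_reals all_analysis.

Set Implicit Arguments.
Unset Strict Implicit.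
Unset Printing Implicit Defensive.

Import Order.TTheory GRing.Theory Num.Theory.
Import numFieldNormedType.Exports.

Local Open Scope classical_set_scope.
Local Open Scope ring_scope.

Section Euclidean.
Context {R : realType} {d : nat}.
Implicit Types (u x y : 'rV[R]_d).

Definition dotv x y : R := \sum_i x 0 i * y 0 i.

(* The library norm on 'rV[R]_d is the sup norm; it induces the same topology. *)
Definition norm2 x : R := Num.sqrt (dotv x x).

Definition reflection u x : 'rV[R]_d := x - (2 * dotv x u) *: u.

Definition halfspace u : set 'rV[R]_d := [set x | 0 < dotv x u].

Definition foldv u x : 'rV[R]_d :=
  if 0 < dotv x u then x else reflection u x.

Definition unit_sphere : set 'rV[R]_d := [set x | norm2 x = 1].

Definition orthogonal_group : set 'M[R]_d := [set Q | Q *m Q^T = 1%:M].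

(* Matrices act on row vectors from the right, see mul_reflection_mx. *)
Definition reflection_mx u : 'M[R]_d := lin1_mx (reflection u).

Definition is_orthogonal_subgroup (H : set 'M[R]_d) : Prop :=
  [/\ H `<=` orthogonal_group,
      H 1%:M,
      forall A B, H A -> H B -> H (A *m B)
    & forall A, H A -> H (invmx A)].

Definition generated_subgroup (S : set 'M[R]_d) : set 'M[R]_d :=
  smallest is_orthogonal_subgroup S.

Lemma dotvC x y : dotv x y = dotv y x.
Proof. by apply: eq_bigr => i _; rewrite mulrC. Qed.

Lemma dotvDl x y z : dotv (x + y) z = dotv x z + dotv y z.
Proof. by rewrite -big_split; apply: eq_bigr => i _; rewrite mxE mulrDl. Qed.

Lemma dotvZl a x y : dotv (a *: x) y = a * dotv x y.
Proof. by rewrite mulr_sumr; apply: eq_bigr => i _; rewrite mxE mulrA. Qed.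

Lemma dotv_ge0 x : 0 <= dotv x x.
Proof. by apply: sumr_ge0 => i _; rewrite -expr2 sqr_ge0. Qed.

Lemma unit_sphereE x : unit_sphere x = (dotv x x = 1).
Proof.
apply/propext; rewrite /unit_sphere /norm2 /=; split=> [h|->]; last exact: sqrtr1.
by rewrite -[LHS]sqr_sqrtr ?dotv_ge0// h expr1n.
Qed.

Lemma foldv_unit_sphere u x : unit_sphere u -> unit_sphere x ->
  unit_sphere (foldv u x).
Proof.
rewrite !unit_sphereE /foldv => u1 x1; case: ifP => // _.
rewrite /reflection -scaleNr dotvDl dotvZl ![dotv _ (x + _)]dotvC !dotvDl.
by rewrite !dotvZl u1 x1 (dotvC u x); ring.
Qed.

Lemma mul_reflection_mx u x : x *m reflection_mx u = reflection u x.
Proof.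
have lin : linear (reflection u).
  move=> a y z; rewrite /reflection dotvDl dotvZl.
  by apply/rowP => i; rewrite !mxE; ring.
pose f := GRing.isLinear.Build _ _ _ _ (reflection u) lin.
pose F : {linear 'rV[R]_d -> 'rV[R]_d} := HB.pack (reflection u) f.
exact: (mul_rV_lin1 F x).
Qed.

End Euclidean.

(* The unit sphere of R^n.+1, with the topology induced by R^n.+1 and its Borel
   sigma-algebra. The ambient dimension is a successor because measurable types
   are pointed, and the unit sphere of R^0 is empty. *)
Definition sphere (R : realType) (n : nat) : Type :=
  set_type (@unit_sphere R n.+1).

Section SphereStructures.
Context {R : realType} {n : nat}.

Definition sphere_val (u : sphere R n) : 'rV[R]_n.+1 := val u.

Lemma sphere_valP (u : sphere R n) : unit_sphere (sphere_val u).
Proof. exact: set_valP. Qed.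

Definition to_sphere (x : 'rV[R]_n.+1) (x1 : unit_sphere x) : sphere R n :=
  exist _ x (mem_set x1).

Lemma unit_sphere_delta : unit_sphere (delta_mx 0 0 : 'rV[R]_n.+1).
Proof.
rewrite unit_sphereE /dotv (bigD1 ord0)//= big1 ?addr0; first by rewrite !mxE mulr1.
by move=> i /negPf i0; rewrite !mxE i0 andbF mul0r.
Qed.

HB.instance Definition _ := PseudoMetric.copy (sphere R n) (set_type (@unit_sphere R n.+1)).
HB.instance Definition _ := isPointed.Build (sphere R n) (to_sphere unit_sphere_delta).

Let borel : set (set (sphere R n)) := <<s @open (sphere R n) >>.

Let borel0 : borel set0.
Proof. exact: sigma_algebra0. Qed.

Let borelC A : borel A -> borel (~` A).
Proof. exact: sigma_algebraC. Qed.

Let borel_bigcup (F : (set (sphere R n))^nat) :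
  (forall i, borel (F i)) -> borel (\bigcup_i F i).
Proof. exact: sigma_algebra_bigcup. Qed.

HB.instance Definition _ :=
  isMeasurable.Build (sigma_display (@open (sphere R n))) (sphere R n)
    borel0 borelC borel_bigcup.

Definition fold (u x : sphere R n) : sphere R n :=
  to_sphere (foldv_unit_sphere (sphere_valP u) (sphere_valP x)).

End SphereStructures.

Section SphereMeasures.
Context {R : realType} {n : nat}.
Implicit Types (mu rho : probability (sphere R n) R) (G : set (sphere R n)).

Definition regular mu : Prop :=
  forall A, measurable A ->
    mu A = ereal_inf [set mu O | O in [set O | open O /\ A `<=` O]] /\
    mu A = ereal_sup [set mu K | K in [set K | compact K /\ K `<=` A]].

Definition is_support mu G : Prop :=
  [/\ closed G, mu G = 1%E
    & forall C, closed C -> mu C = 1%E -> G `<=` C].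

Definition halfspaces_cover G : Prop :=
  unit_sphere `<=` \bigcup_(u in G) halfspace (sphere_val u).

Definition reflections_generate_dense G : Prop :=
  orthogonal_group `<=`
  closure (generated_subgroup [set reflection_mx (sphere_val u) | u in G]).

Definition stationary mu rho : Prop :=
  forall A, measurable A -> rho A = (\int[mu]_u rho (fold u @^-1` A))%E.

(* Measures are compared on Borel sets only. *)
Definition is_unique_stationary mu rho : Prop :=
  [/\ regular rho, stationary mu rho
    & forall rho', regular rho' -> stationary mu rho' ->
        forall A, measurable A -> rho' A = rho A].

End SphereMeasures.

Definition independent {d d' : measure_display} {T : measurableType d}
    {T' : measurableType d'} {R : realType} (P : probability T R)
    (I : choiceType) (D : set I) (U : I -> {RV P >-> T'}) : Prop :=
  forall (J : {fset I}) (B : I -> set T'),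
    [set` J] `<=` D -> (forall i, i \in J -> measurable (B i)) ->
    P (\bigcap_(i in [set` J]) (U i @^-1` B i)) =
    (\prod_(i <- J) P (U i @^-1` B i))%E.

Definition iid {d d' : measure_display} {T : measurableType d}
    {T' : measurableType d'} {R : realType} (P : probability T R)
    (I : choiceType) (D : set I) (U : I -> {RV P >-> T'})
    (mu : probability T' R) : Prop :=
  independent D U /\
  forall i, D i -> forall A, measurable A -> distribution P (U i) A = mu A.

Section Walk.
Context {R : realType} {n : nat}.

(* u 0 is never used. *)
Fixpoint walk (u : nat -> sphere R n) (x : sphere R n) (k : nat) : sphere R n :=
  if k is k'.+1 then fold (u k) (walk u x k') else x.

Definition visits (X : nat -> sphere R n) (A : set (sphere R n)) (N : nat) : nat :=
  #|[pred k : 'I_N.+1 | (1 <= k)%N && (X k \in A)]|.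

End Walk.

(* Main.v *)
(* Put the walk on a path space: with (U_(k+1))_k distributed according to the
   product law Q, the map (x, v) |-> (F_(v_0) x, shift v) preserves rho x Q.
   Let B be an invariant set. The fiber function p(x) = Q(B_x) is harmonic, so
   p(F_u x) = p(x) for mu x rho almost every (u, x) by a variance computation;
   hence the first marginal of rho x Q restricted to B is stationary, and by
   uniqueness it is proportional to rho. So the maximal ergodic inequality on B
   reads c P(B, sup_N sum_(n <= N) (1_A(X_n) - c) > 0) <= rho(A) P(B). For
   c > rho(A) and B = {sup_N sum_(n <= N) (1_A(X_n) - c) = oo} this gives
   P(B) = 0, which bounds the upper frequency of visits to A by rho(A); the
   lower bound is the same statement for the complement of A. *)
Require Import Defs.
From HB Require Import structures.
From mathcomp Require Import all_boot all_order all_algebra.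
From mathcomp Require Import finmap ring lra.
From mathcomp Require Import all_classical all_reals all_analysis.
From mathcomp Require Import measurable_realfun.

Set Implicit Arguments.
Unset Strict Implicit.
Unset Printing Implicit Defensive.

Import Order.TTheory GRing.Theory Num.Theory.
Import numFieldNormedType.Exports.

Local Open Scope classical_set_scope.
Local Open Scope ring_scope.

Lemma indic_le1 {T : Type} {R : realType} (A : set T) z : \1_A z <= 1 :> R.
Proof. by rewrite indicE lern1 leq_b1. Qed.

(** * Sums of visits minus a linear rate along an orbit *)

Section Excess.
Context {Z : Type} {R : realType} (T : Z -> Z) (A : set Z) (c : R).

(** The first term is taken at [T z], not at [z], because visits are counted from time 1 on. *)
Fixpoint excess (N : nat) (z : Z) : R :=
  if N is N'.+1 then \1_A (T z) - c + excess N' (T z) else 0.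

(** This is the maximum of [excess k z] over [k <= N], in the recursive form that Garsia's argument
    uses. *)
Fixpoint max_excess (N : nat) (z : Z) : R :=
  if N is N'.+1 then Num.max 0 (\1_A (T z) - c + max_excess N' (T z)) else 0.

Definition unbounded_excess : set Z :=
  [set z | forall K : nat, exists N, K%:R < excess N z].

Lemma max_excess_ge0 N z : 0 <= max_excess N z.
Proof. by case: N => //= N; rewrite le_max lexx. Qed.

Lemma le_max_excess N z : max_excess N z <= max_excess N.+1 z.
Proof.
elim: N z => [|N IHN] z; first exact: max_excess_ge0.
rewrite /= ge_max !le_max lexx /=; apply/orP; right.
by rewrite lerD2l; exact: IHN.
Qed.

Lemma excess_le_max N z : excess N z <= max_excess N z.
Proof.
by elim: N z => //= N IHN z; rewrite le_max lerD2l IHN orbT.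
Qed.

(** Boundedness makes the integral of [max_excess] finite, so that it can be cancelled later. *)
Lemma max_excess_le N z : 0 <= c -> max_excess N z <= N%:R.
Proof.
move=> c0; elim: N z => [|N IHN] z; first by rewrite lexx.
rewrite [max_excess _ _]/= ge_max ler0n -natr1 addrC lerD//.
by rewrite lerBlDr (le_trans (indic_le1 _ _))// lerDl.
Qed.

(* Garsia's pointwise form of the maximal ergodic inequality. *)
Lemma max_excess_step N z :
  max_excess N z + c * \1_[set z | 0 < max_excess N z] z <=
  \1_A (T z) + max_excess N (T z).
Proof.
case: N => [|N].
  by rewrite indicE memNset /= ?ltxx// mulr0 !addr0.
have M0 := max_excess_ge0 N.+1 (T z); have MN := le_max_excess N (T z).
have A0 : 0 <= (\1_A (T z) : R) by rewrite indicE ler0n.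
have [M|M] := ltP 0 (max_excess N.+1 z).
  rewrite indicE mem_set// mulr1.
  move: M; rewrite /= lt_max ltxx /= => M.
  rewrite max_r ?(ltW M)// addrAC subrK lerD2l; exact: MN.
rewrite indicE memNset ?mulr0 ?addr0; last by apply/negP; rewrite -leNgt.
by rewrite (le_trans M)// addr_ge0.
Qed.

(** One step along the orbit changes the sums by a term between [- c] and [1], which cannot affect
    unboundedness. *)
Lemma unbounded_excess_invariant : 0 <= c ->
  T @^-1` unbounded_excess = unbounded_excess.
Proof.
move=> c0; apply/seteqP; split=> z /= zB K.
  (* The margin [k] absorbs a loss of at most [c] in the extra first term. *)
  have [k ck] : exists k : nat, c <= k%:R.
    by exists (Num.trunc c).+1; rewrite ltW// truncnS_gt.
  have [N] := zB (K + k)%N; rewrite natrD => KN; exists N.+1 => /=.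
  rewrite -addrA ltr_wpDl ?indicE//.
  by rewrite -ltrBlDl opprK (le_lt_trans _ KN)// lerD2l.
(* The margin 1 absorbs the dropped first term and rules out the empty sum. *)
have [[|N] KN] := zB K.+1; first by move: KN; rewrite /= ltrn0.
exists N; move: KN; rewrite -natr1 /= -ltrBrDr => /lt_le_trans; apply.
rewrite lerBlDr addrC lerD2l lerBlDr (le_trans (indic_le1 _ _))//.
by rewrite lerDl.
Qed.

End Excess.

(** * Maximal ergodic inequality on an invariant set *)

Section MaximalErgodic.
Context d (Z : measurableType d) (R : realType) (m : probability Z R).
Context (T : Z -> Z) (A : set Z) (c : R).
Hypotheses (mT : measurable_fun setT T) (mA : measurable A) (c0 : 0 <= c).
Hypothesis preserving : forall W, measurable W -> m (T @^-1` W) = m W.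

Local Notation S := (excess T A c).
Local Notation M := (max_excess T A c).

Lemma measurable_excess N : measurable_fun setT (S N).
Proof.
elim: N => [|N IHN]; first exact: measurable_cst.
apply: measurable_funD; last exact: measurableT_comp.
by apply: measurable_funB => //; apply: measurableT_comp.
Qed.

Lemma measurable_max_excess N : measurable_fun setT (M N).
Proof.
elim: N => [|N IHN]; first exact: measurable_cst.
apply: measurable_maxr => //.
apply: measurable_funD; last exact: measurableT_comp.
by apply: measurable_funB => //; apply: measurableT_comp.
Qed.

Lemma measurable_unbounded_excess : measurable (unbounded_excess T A c).
Proof.
rewrite (_ : unbounded_excess _ _ _ =
  \bigcap_(K : nat) \bigcup_N [set z | K%:R < S N z]).
  apply: bigcapT_measurable => K; apply: bigcupT_measurable => N.
  rewrite -[X in measurable X]setTI.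
  by apply: measurable_fun_ltr => //; exact: measurable_excess.
apply/seteqP; split=> z zB K; first by move=> _; have [N] := zB K; exists N.
by have [N _] := zB K I; exists N.
Qed.

(** Integrate [max_excess_step] over [B]: as [T] preserves both [m] and [B], the integrals of [M K]
    and of [M K] after [T] agree and cancel. *)
Lemma maximal_ergodic_inequality B K : measurable B -> T @^-1` B = B ->
  (c%:E * m (B `&` [set z | (0 < M K z)%R]) <= m (B `&` A))%E.
Proof.
move=> mB TB; set E := [set z | _].
have mE : measurable E.
  rewrite /E -[X in measurable X]setTI.
  by apply: measurable_fun_ltr => //; exact: measurable_max_excess.
have mMK : measurable_fun setT (EFin \o M K).
  by apply/measurable_EFinP; exact: measurable_max_excess.
have intMT : (\int[m]_(z in B) (M K (T z))%:E = \int[m]_(z in B) (M K z)%:E)%E.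
  transitivity (\int[m]_(z in T @^-1` B) (M K (T z))%:E)%E; first by rewrite TB.
  have/= <- := @ge0_integral_pushforward _ _ _ _ _ _ mT m B (EFin \o M K) mB.
  - apply: eq_measure_integral => W mW _; exact: preserving.
  - exact: measurable_funTS.
  - by move=> z _; rewrite lee_fin max_excess_ge0.
have intM_fin : (\int[m]_(z in B) (M K z)%:E)%E \is a fin_num.
  rewrite ge0_fin_numE; last first.
    by apply: integral_ge0 => z _; rewrite lee_fin max_excess_ge0.
  apply: (@le_lt_trans _ _ (\int[m]_(z in B) cst K%:R%:E z)%E).
    apply: ge0_le_integral => //.
    - by move=> z _; rewrite lee_fin max_excess_ge0.
    - exact: measurable_funTS.
    - by move=> z _; rewrite lee_fin max_excess_le.
  rewrite integral_cst// lte_mul_pinfty// ?lee_fin//.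
  by rewrite (le_lt_trans (probability_le1 _ _))// ltry.
have mTA : measurable (T @^-1` A).
  by rewrite -[X in measurable X]setTI; exact: mT.
(* Adding the finite integral of [M K] to both sides turns the goal into the integrated pointwise
   inequality. *)
rewrite -(leeD2lE _ _ intM_fin).
have -> : m (B `&` A) = m (B `&` T @^-1` A).
  by rewrite -(preserving (measurableI _ _ mB mA)) preimage_setI TB.
have -> : m (B `&` T @^-1` A) = (\int[m]_(z in B) (\1_A (T z))%:E)%E.
  by rewrite setIC -integral_indic.
have -> : (c%:E * m (B `&` E) = \int[m]_(z in B) (c * \1_E z)%:E)%E.
  under eq_integral do rewrite EFinM.
  rewrite ge0_integralZl//.
    by rewrite integral_indic// setIC.
  by apply/measurable_EFinP; exact: measurable_funTS.
rewrite -[X in (_ <= X + _)%E]intMT.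
have mMKT : measurable_fun B (fun z => (M K (T z))%:E).
  by apply: measurable_funTS; exact: (measurableT_comp mMK mT).
have mA' : measurable_fun B (fun z => (\1_A (T z))%:E : \bar R).
  by apply/measurable_EFinP/measurable_funTS; exact: measurableT_comp.
have mE' : measurable_fun B (fun z => (c * \1_E z)%:E : \bar R).
  by apply/measurable_EFinP/measurable_funTS; exact: measurable_funM.
have mMKB : measurable_fun B (fun z => (M K z)%:E) by exact: measurable_funTS.
have M0 z : (0 <= (M K z)%:E)%E by rewrite lee_fin max_excess_ge0.
have E0 z : (0 <= (c * \1_E z)%:E)%E by rewrite lee_fin mulr_ge0.
rewrite -!ge0_integralD//.
apply: ge0_le_integral => //.
- by move=> z _; rewrite adde_ge0.
- exact: emeasurable_funD.
- exact: emeasurable_funD.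
- by move=> z _; rewrite -!EFinD lee_fin [leRHS]addrC max_excess_step.
Qed.

(** Letting [K] grow in the maximal inequality yields [c * m B <= a * m B], which forces [m B = 0]
    since [a < c]. *)
Lemma unbounded_excess_null (a : R) (B := unbounded_excess T A c) :
  a < c -> m (B `&` A) = (a%:E * m B)%E -> m B = 0%E.
Proof.
move=> ac mBA; have mB : measurable B := measurable_unbounded_excess.
have TB : T @^-1` B = B by exact: unbounded_excess_invariant.
pose E K := B `&` [set z | 0 < M K z].
have mE K : measurable (E K).
  apply: measurableI => //; rewrite -[X in measurable X]setTI.
  by apply: measurable_fun_ltr => //; exact: measurable_max_excess.
(* On [B] some excess is positive, hence some [M K] is; the sets [E K] increase to [B]. *)
have EB : \bigcup_K E K = B.
  apply/seteqP; split=> [z [K _ []]//|z Bz].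
  have [N SN] := Bz 0; exists N => //; split => //=.
  exact: lt_le_trans SN (excess_le_max _ _ _ _ _).
have : (c%:E * m (E K))%E @[K --> \oo] --> (c%:E * m B)%E.
  apply: cvgeZl => //; rewrite -EB; apply: nondecreasing_cvg_mu => //.
    by rewrite EB.
  apply/nondecreasing_seqP => K; apply/subsetPset => z [Bz Mz]; split => //=.
  exact: lt_le_trans Mz (le_max_excess _ _ _ _ _).
move=> /cvge_to_le cm.
have {}cm : (c%:E * m B <= m (B `&` A))%E.
  by apply: cm; apply: nearW => K; exact: maximal_ergodic_inequality.
move: cm; rewrite mBA => cm; apply: contraTeq cm => m0.
rewrite -ltNge lte_pmul2r//.
- by rewrite ge0_fin_numE// (le_lt_trans (probability_le1 _ _))// ltry.
- by rewrite lt0e m0/=.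
Qed.
End MaximalErgodic.

(** * From bounded excess to convergence of frequencies *)

Section Frequency.
Context {Z : Type} {R : realType} (T : Z -> Z) (A : set Z).

Lemma excessE (B : set Z) (c : R) N z :
  excess T B c N z = \sum_(i < N) \1_B (iter i.+1 T z) - c * N%:R.
Proof.
elim: N z => [|N IHN] z; first by rewrite /= big_ord0 mulr0 subr0.
rewrite -[LHS]/(\1_B (T z) - c + excess T B c N (T z)) IHN.
rewrite big_ord_recl -natr1 mulrDr mulr1.
under [in RHS]eq_bigr do rewrite iterSr.
by rewrite -[iter _ _ _]/(T z); ring.
Qed.

Lemma excess_bounded (B : set Z) (c : R) z : ~ unbounded_excess T B c z ->
  exists K : nat, forall N, excess T B c N z <= K%:R.
Proof.
move=> /existsNP[K /forallNP HK]; exists K => N.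
by rewrite leNgt; apply/negP.
Qed.

(** A bounded excess over the rate [c] gives at most [c * N + K] visits. The rates slightly above
    [a] bound the frequency from above, and those for the complement bound it from below. *)
Lemma frequency_cvg (a : R) z :
  (forall k : nat, ~ unbounded_excess T A (a + k.+1%:R^-1) z) ->
  (forall k : nat, ~ unbounded_excess T (~` A) (1 - a + k.+1%:R^-1) z) ->
  (N%:R^-1 * \sum_(i < N) \1_A (iter i.+1 T z)) @[N --> \oo] --> a.
Proof.
move=> upper lower; apply/cvgrPdist_le => /= e e0.
have e2 : 0 < e / 2 by rewrite divr_gt0.
(* Half of [e] pays for the surplus [1/(k+1)] in the rate, the other half for the constant [K]
   divided by [N]. *)
have [k ke] : exists k : nat, k.+1%:R^-1 <= e / 2.
  exists (Num.trunc (e / 2)^-1); rewrite invf_ple ?posrE//.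
  by rewrite ltW// truncnS_gt.
have [K1 HK1] := excess_bounded (upper k).
have [K2 HK2] := excess_bounded (lower k).
pose K : R := (K1 + K2)%:R.
near=> N.
have KN : K <= e / 2 * N%:R.
  near: N; exists (Num.trunc (K / (e / 2))).+1 => // N /= KN.
  rewrite mulrC -ler_pdivrMr// ltW// (lt_le_trans (truncnS_gt _))//.
  by rewrite ler_nat.
have N0 : 0 < N%:R :> R by rewrite ltr0n; near: N; exists 1.
have := HK1 N; have := HK2 N; rewrite !excessE.
set s := \sum_(i < N) \1_A _.
have -> : \sum_(i < N) \1_(~` A) (iter i.+1 T z) = N%:R - s.
  rewrite /s -[N in N%:R]card_ord -sum1_card natr_sum -sumrB.
  apply: eq_bigr => i _; rewrite indicC [in RHS]indicE.
  by case: (_ \in _); rewrite ?subrr ?subr0.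
have -> : a - N%:R^-1 * s = N%:R^-1 * (a * N%:R - s).
  by rewrite mulrBr mulrCA mulVf ?mulr1// gt_eqF.
rewrite normrM gtr0_norm ?invr_gt0// ler_pdivrMl// ler_norml.
have : k.+1%:R^-1 * N%:R <= e / 2 * N%:R by rewrite ler_pM2r.
move: KN; rewrite /K natrD.
have := ler0n R K1; have := ler0n R K2.
move: (k.+1%:R^-1) => q *; apply/andP; split; lra.
Unshelve. all: by end_near. Qed.
End Frequency.

Definition mfun_pack d d' (T : measurableType d) (T' : measurableType d')
    (f : T -> T') (mf : measurable_fun setT f) : {mfun T >-> T'} :=
  HB.pack f (isMeasurableFun.Build _ _ _ _ f mf).

(** * Sequence space with the product sigma-algebra *)

Section Sequences.
Context d (Y : measurableType d).

Definition box (m : nat) (B : nat -> set Y) : set (nat -> Y) :=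
  [set v | forall i, (i < m)%N -> B i (v i)].

(** The cylinder sets: a generating family closed under intersection, so a probability is determined
    by its values on them. *)
Definition boxes : set (set (nat -> Y)) :=
  [set V | exists m B, (forall i, measurable (B i)) /\ V = box m B].

Definition sequences := g_sigma_algebraType boxes.

HB.instance Definition _ := Measurable.on sequences.

Definition cons_seq (z : Y * sequences) : sequences :=
  fun i => if i is j.+1 then z.2 j else z.1.

Definition shift_seq (v : sequences) : sequences := fun i => v i.+1.

Lemma box_measurable m B : (forall i, measurable (B i)) ->
  measurable (box m B : set sequences).
Proof. by move=> mB; apply: sub_sigma_algebra; exists m, B. Qed.

Lemma boxes_setI_closed : setI_closed boxes.
Proof.
move=> _ _ [m [B [mB ->]]] [k [C [mC ->]]].
(* The shorter box is padded with [setT] to the common length. *)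
exists (maxn m k), (fun i => (if (i < m)%N then B i else setT) `&`
                             (if (i < k)%N then C i else setT)); split.
  by move=> i; apply: measurableI; case: ifP.
apply/seteqP; split=> v.
  by move=> [vB vC] i _; split; case: ifP => // ?; [exact: vB|exact: vC].
move=> vBC; split=> i im.
  have /vBC[] : (i < maxn m k)%N by rewrite leq_max im.
  by rewrite im.
have /vBC[] : (i < maxn m k)%N by rewrite leq_max im orbT.
by rewrite im.
Qed.

Lemma measurable_coordinate i : measurable_fun setT (fun v : sequences => v i).
Proof.
move=> _ A mA; rewrite setTI.
rewrite (_ : _ @^-1` _ = box i.+1 (fun j => if j == i then A else setT)).
  by apply: box_measurable => j; case: ifP.
apply/seteqP; split=> v /=.
  by move=> vA j _; case: eqP => // ->.
by move=> /(_ i (ltnSn i)); rewrite eqxx.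
Qed.

Lemma measurable_sequence d' (T : measurableType d') (f : T -> sequences) :
  (forall i, measurable_fun setT (fun t => f t i)) -> measurable_fun setT f.
Proof.
move=> mf; apply: (@measurability _ _ T sequences setT f boxes erefl).
move=> _ [_ [m [B [mB ->]]] <-]; rewrite setTI.
rewrite (_ : _ @^-1` _ =
  \bigcap_i (if (i < m)%N then (fun t => f t i) @^-1` B i else setT)).
  apply: bigcapT_measurable => i; case: ifP => // _.
  by rewrite -[X in measurable X]setTI; exact: mf.
apply/seteqP; split=> t /=; first by move=> ft i _; case: ifP => // /ft.
by move=> ft i im; have := ft i I; rewrite im.
Qed.

Lemma measurable_cons_seq : measurable_fun setT cons_seq.
Proof.
apply: measurable_sequence => -[|i]; first exact: measurable_fst.
by apply: (measurableT_comp (measurable_coordinate i)); exact: measurable_snd.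
Qed.

Lemma measurable_shift_seq : measurable_fun setT shift_seq.
Proof. by apply: measurable_sequence => i; exact: measurable_coordinate. Qed.

End Sequences.

(** * Product laws on sequences *)

Section ProductLaw.
Context d (Y : measurableType d) (R : realType).
Context (mu : probability Y R) (Q : probability (sequences Y) R).

Definition product_law := forall m (B : nat -> set Y),
  (forall i, measurable (B i)) -> Q (box m B) = (\prod_(i < m) mu (B i))%E.

Hypothesis Q_law : product_law.

(** Prepending an independent letter of law [mu] reproduces [Q]: on boxes the product splits off its
    first factor, and boxes determine the measure. *)
Lemma product_law_cons V : measurable V ->
  Q V = (mu \x Q)%E (@cons_seq _ Y @^-1` V).
Proof.
move=> mV.
apply: (@measure_unique _ R (sequences Y) (@boxes _ Y) (fun=> setT) _ _ _ _ Q
  (distribution (mu \x Q)%E (mfun_pack (@measurable_cons_seq _ Y)))) => //.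
- exact: boxes_setI_closed.
- move=> _; exists 0%N, (fun=> setT); split=> //.
  by apply/seteqP; split.
- by apply/seteqP; split=> // v _; exists 0%N.
- move=> _ [m [B [mB ->]]]; apply: etrans (Q_law _ mB) _.
  rewrite /= /distribution /pushforward.
  case: m => [|m].
    rewrite big_ord0 (_ : _ @^-1` _ = setT) ?probability_setT//.
    by apply/seteqP; split.
  rewrite big_ord_recl (_ : _ @^-1` _ = B 0%N `*` box m (fun i => B i.+1)).
    rewrite product_measure1E//; last exact: box_measurable.
    by congr (_ * _)%E; apply/esym/Q_law.
  apply/seteqP; split=> -[y v] /=.
    by move=> yv; split=> [|i im]; [exact: (yv 0%N)|exact: (yv i.+1)].
  by move=> [By Bv] [|i] im //=; exact: Bv.
- by move=> _; rewrite (le_lt_trans (probability_le1 _ _))// ltry.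
Qed.
End ProductLaw.

(** * The skew product and its invariant measure *)

Section RandomDynamics.
Context dX dY (X : measurableType dX) (Y : measurableType dY) (R : realType).
Context (f : Y -> X -> X) (mu : probability Y R) (rho : probability X R).

(** Taking a bare set function lets this apply to the unnormalized [marginal] below. *)
Definition stationary_under (nu : set X -> \bar R) := forall A, measurable A ->
  nu A = (\int[mu]_u nu (f u @^-1` A))%E.

Hypothesis mf : measurable_fun setT (fun z : Y * X => f z.1 z.2).

(** Stationarity says that [nu] is the image of [mu \x nu] under the step map; this is the change of
    variables. *)
Lemma stationary_under_integral (nu : probability X R) (h : X -> \bar R) :
  stationary_under nu -> measurable_fun setT h -> (forall x, 0 <= h x)%E ->
  (\int[mu \x nu]_z h (f z.1 z.2) = \int[nu]_x h x)%E.
Proof.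
move=> nu_st mh h0.
have := @ge0_integral_pushforward _ _ _ _ R _ mf (mu \x nu)%E setT h
  measurableT mh.
move=> /(_ (fun _ _ => h0 _)); rewrite preimage_setT => <-.
apply: eq_measure_integral => A mA _; apply/esym; apply: etrans (nu_st _ mA) _.
by apply: eq_integral => y _; congr (nu _); rewrite xsectionE.
Qed.

Hypothesis rho_st : stationary_under rho.
Context (Q : probability (sequences Y) R).
Hypothesis Q_law : product_law mu Q.

Definition skew (z : X * sequences Y) : X * sequences Y :=
  (f (z.2 0%N) z.1, shift_seq z.2).

Lemma measurable_skew : measurable_fun setT skew.
Proof.
apply: measurable_fun_pair.
  have mg : measurable_fun setT (fun z : X * sequences Y => (z.2 0%N, z.1)).
    apply: measurable_fun_pair; last exact: measurable_fst.
    exact: (measurableT_comp (@measurable_coordinate _ Y 0) measurable_snd).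
  exact: (measurableT_comp mf mg).
exact: (measurableT_comp (@measurable_shift_seq _ Y) measurable_snd).
Qed.

Lemma measurable_preimage_skew W : measurable W -> measurable (skew @^-1` W).
Proof.
by move=> mW; rewrite -[X in measurable X]setTI; exact: measurable_skew.
Qed.

Definition fiber (W : set (X * sequences Y)) (x : X) : \bar R :=
  Q (xsection W x).

Lemma measurable_fiber W : measurable W -> measurable_fun setT (fiber W).
Proof. exact: measurable_fun_xsection. Qed.

(** Splitting off the first letter [y] leaves a sequence of law [Q] attached to the new position
    [f y x]. *)
Lemma fiber_preimage_skew W x : measurable W ->
  fiber (skew @^-1` W) x = (\int[mu]_y fiber W (f y x))%E.
Proof.
move=> mW; rewrite /fiber (product_law_cons Q_law)//; last first.
  apply: measurable_xsection; exact: measurable_preimage_skew.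
apply: eq_integral => y _ /=; congr (Q _).
by rewrite !xsectionE.
Qed.

(** Integrate the fiber identity over [rho], exchange the integrals by Tonelli, and use stationarity
    for the function [fiber W]. *)
Lemma skew_preserving W : measurable W ->
  (rho \x Q)%E (skew @^-1` W) = (rho \x Q)%E W.
Proof.
move=> mW; rewrite /= /product_measure1.
transitivity (\int[rho]_x \int[mu]_y fiber W (f y x))%E.
  apply: eq_integral => x _; exact: (fiber_preimage_skew x mW).
have mh : measurable_fun setT (fun z : Y * X => fiber W (f z.1 z.2)).
  exact: (measurableT_comp (measurable_fiber mW) mf).
apply: etrans (esym (fubini_tonelli2 _ mh _)) _ => //.
by apply: (stationary_under_integral rho_st) => //; exact: measurable_fiber.
Qed.

End RandomDynamics.

(** * Invariant sets of the skew product and their marginals *)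

Section InvariantSet.
Context dX dY (X : measurableType dX) (Y : measurableType dY) (R : realType).
Context (f : Y -> X -> X) (mu : probability Y R) (rho : probability X R).
Hypothesis mf : measurable_fun setT (fun z : Y * X => f z.1 z.2).
Hypothesis rho_st : stationary_under f mu rho.
Context (Q : probability (sequences Y) R).
Hypothesis Q_law : product_law mu Q.
Local Notation fiber := (fiber Q).
Local Notation skew := (skew f).
Context (B : set (X * sequences Y)).
Hypotheses (mB : measurable B) (skewB : skew @^-1` B = B).

Let q (x : X) : R := fine (fiber B x).

Let fiberE x : fiber B x = (q x)%:E.
Proof.
rewrite /q fineK// ge0_fin_numE//.
rewrite (le_lt_trans (probability_le1 Q _)) ?ltry//.
exact: measurable_xsection.
Qed.

Let q0 x : 0 <= q x.
Proof. by rewrite -lee_fin -fiberE. Qed.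

Let q1 x : q x <= 1.
Proof.
rewrite -lee_fin -fiberE; apply: probability_le1.
exact: measurable_xsection.
Qed.

Let mq : measurable_fun setT q.
Proof.
by apply: measurableT_comp => //; exact: measurable_fiber.
Qed.

Let mqf : measurable_fun setT (fun z : Y * X => q (f z.1 z.2)).
Proof. exact: (measurableT_comp mq mf). Qed.

Let mq2 : measurable_fun setT (fun z : Y * X => q z.2).
Proof. exact: (measurableT_comp mq measurable_snd). Qed.

Let q_harmonic x : ((q x)%:E = \int[mu]_y (q (f y x))%:E)%E.
Proof.
rewrite -fiberE -{1}skewB (fiber_preimage_skew mf Q_law)//.
by apply: eq_integral => y _; rewrite fiberE.
Qed.

(* The variance of [q (f u x)] under [mu \x rho] given [x] integrates to
   [\int q^2 - \int q^2 = 0], because [q] is harmonic and [rho] stationary. *)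
Let q_along_step : (\int[mu \x rho]_z ((q (f z.1 z.2) - q z.2) ^+ 2)%:E = 0)%E.
Proof.
pose I := (\int[rho]_x ((q x) ^+ 2)%:E)%E.
have mqq : measurable_fun setT (fun x => ((q x) ^+ 2)%:E).
  by apply/measurable_EFinP; exact: measurable_funX.
have mcross : measurable_fun setT (fun z : Y * X => (q (f z.1 z.2) * q z.2)%:E).
  by apply/measurable_EFinP; exact: measurable_funM.
have I_fin : I \is a fin_num.
  rewrite ge0_fin_numE; last first.
    by apply: integral_ge0 => x _; rewrite lee_fin sqr_ge0.
  apply: (@le_lt_trans _ _ (\int[rho]_x cst 1 x)%E).
    apply: ge0_le_integral => //.
    - by move=> x _; rewrite lee_fin sqr_ge0.
    - by move=> x _; rewrite lee_fin expr_le1.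
  by rewrite integral_cst//= mul1e (le_lt_trans (probability_le1 _ _))// ltry.
have sq_step : (\int[mu \x rho]_z ((q (f z.1 z.2)) ^+ 2)%:E = I)%E.
  apply: (stationary_under_integral mf rho_st mqq) => x.
  by rewrite lee_fin sqr_ge0.
have sq_stay : (\int[mu \x rho]_z ((q z.2) ^+ 2)%:E = I)%E.
  rewrite fubini_tonelli2//; last 2 first.
  - exact: (measurableT_comp mqq measurable_snd).
  - by move=> z; rewrite lee_fin sqr_ge0.
  apply: eq_integral => x _; rewrite /fubini_G /= integral_cst//.
  by rewrite [X in (_ * X)%E](@probability_setT _ _ _ mu) ?mule1//.
have cross : (\int[mu \x rho]_z (q (f z.1 z.2) * q z.2)%:E = I)%E.
  rewrite fubini_tonelli2//; last by move=> z; rewrite lee_fin mulr_ge0.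
  apply: eq_integral => x _; rewrite /fubini_G [LHS]/=.
  have mqfx : measurable_fun setT (fun y => (q (f y x))%:E).
    by apply/measurable_EFinP; exact: (measurable_fun_pair1 x mqf).
  transitivity (\int[mu]_y ((q x)%:E * (q (f y x))%:E))%E.
    by apply: eq_integral => y _; rewrite -EFinM mulrC.
  have qfx0 y : setT y -> (0 <= (q (f y x))%:E)%E by rewrite lee_fin.
  have qx0 : (0 <= (q x)%:E)%E by rewrite lee_fin.
  rewrite (ge0_integralZl mu measurableT mqfx qfx0 qx0).
  by rewrite -q_harmonic -EFinM expr2.
pose D (z : Y * X) := ((q (f z.1 z.2) - q z.2) ^+ 2)%:E.
have mD : measurable_fun setT D.
  by apply/measurable_EFinP/measurable_funX; exact: measurable_funB.
have D0 z : (0 <= D z)%E by rewrite lee_fin sqr_ge0.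
have cr0 (z : Y * X) : (0 <= (q (f z.1 z.2) * q z.2)%:E)%E.
  by rewrite lee_fin mulr_ge0.
have EII1 : (I + I = \int[mu \x rho]_z
    ((q (f z.1 z.2) * q z.2)%:E + (q (f z.1 z.2) * q z.2)%:E))%E.
  by rewrite (ge0_integralD (mu \x rho)%E)// cross.
have EII2 : (I + I = \int[mu \x rho]_z
    ((q (f z.1 z.2) ^+ 2)%:E + (q z.2 ^+ 2)%:E))%E.
  rewrite (ge0_integralD (mu \x rho)%E)//.
  - by rewrite sq_step sq_stay.
  - by move=> z _; rewrite lee_fin sqr_ge0.
  - by apply/measurable_EFinP/measurable_funX.
  - by move=> z _; rewrite lee_fin sqr_ge0.
  - by apply/measurable_EFinP/measurable_funX.
(* The expanded square with the cross terms moved to the left: all integrands are nonnegative, and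
   the finite [I + I] is subtracted only at the end. *)
have E : (\int[mu \x rho]_z D z + (I + I) = I + I)%E.
  rewrite [in LHS]EII1 EII2 -(ge0_integralD (mu \x rho)%E)//.
  - by apply: eq_integral => z _; rewrite -!EFinD; congr EFin; ring.
  - by move=> z _; rewrite adde_ge0.
  - exact: emeasurable_funD.
have II_fin : (I + I)%E \is a fin_num by rewrite fin_numD I_fin.
rewrite -[LHS](addeK _ II_fin).
by apply: (etrans (congr1 (fun a => a - (I + I))%E E)); rewrite subee.
Qed.

Let q_invariant_ae :
  {ae (mu \x rho)%E, forall z : Y * X, q (f z.1 z.2) = q z.2}.
Proof.
have mD : measurable_fun setT
    (fun z : Y * X => ((q (f z.1 z.2) - q z.2) ^+ 2)%:E).
  by apply/measurable_EFinP/measurable_funX; exact: measurable_funB.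
have /(ae_eq_integral_abs (mu \x rho)%E measurableT mD) :
    (\int[mu \x rho]_z `|((q (f z.1 z.2) - q z.2) ^+ 2)%:E| = 0)%E.
  rewrite -[RHS]q_along_step; apply: eq_integral => z _.
  by rewrite gee0_abs// lee_fin sqr_ge0.
apply: filterS => z /(_ I) [] /eqP.
by rewrite sqrf_eq0 subr_eq0 => /eqP.
Qed.

Definition marginal (A : set X) : \bar R := (rho \x Q)%E (B `&` (A `*` setT)).

Let marginalE A : measurable A ->
  marginal A = (\int[rho]_x (\1_A x * q x)%:E)%E.
Proof.
move=> mA; apply: eq_integral => x _ /=.
rewrite xsectionI EFinM -fiberE indicE.
have [xA|xA] := boolP (x \in A).
  by rewrite in_xsectionX// setIT mul1e.
by rewrite notin_xsectionX// setI0 measure0 mul0e.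
Qed.

(** The marginal has density [q] with respect to [rho]. Stationarity of [rho] replaces [x] by
    [f y x] in both factors, and almost everywhere [q (f y x)] may be turned back into [q x]. *)
Lemma marginal_stationary : stationary_under f mu marginal.
Proof.
move=> A mA; rewrite marginalE//.
have mAq : measurable_fun setT (fun x => (\1_A x * q x)%:E).
  by apply/measurable_EFinP; exact: measurable_funM.
have A0 (x x' : X) : (0 <= (\1_A x * q x')%:E)%E.
  by rewrite lee_fin mulr_ge0// indicE.
have mAf : measurable_fun setT (fun z : Y * X => \1_A (f z.1 z.2) : R).
  exact: (measurableT_comp (measurable_indic mA) mf).
rewrite -(stationary_under_integral mf rho_st mAq)//.
transitivity (\int[mu \x rho]_z (\1_A (f z.1 z.2) * q z.2)%:E)%E.
  apply: ge0_ae_eq_integral => //.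
  - by apply/measurable_EFinP; exact: measurable_funM.
  - by apply/measurable_EFinP; exact: measurable_funM.
  - by apply: filterS q_invariant_ae => z -> _.
rewrite fubini_tonelli1//; last first.
  by apply/measurable_EFinP; exact: measurable_funM.
apply: eq_integral => y _; rewrite marginalE//.
by rewrite -[X in measurable X]setTI; exact: (measurable_fun_pair2 y mf).
Qed.

(** This domination later transfers regularity from [rho] to the normalized marginal. *)
Lemma marginal_le A : measurable A -> (marginal A <= rho A)%E.
Proof.
move=> mA; rewrite -[leRHS]mule1 -(@probability_setT _ _ _ Q).
rewrite -product_measure1E// le_measure ?inE//; last exact: measurableX.
by apply: measurableI => //; exact: measurableX.
Qed.

End InvariantSet.

(** The nonnegative function [Q (xsection W x)] has integral zero, so it vanishes almost
    everywhere. *)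
Lemma ae_sections d d' (X : measurableType d) (V : measurableType d')
    (R : realType) (rho : probability X R) (Q : probability V R)
    (W : set (X * V)) : measurable W -> (rho \x Q)%E W = 0%E ->
  {ae rho, forall x, {ae Q, forall v, ~ W (x, v)}}.
Proof.
move=> mW W0.
have mQ : measurable_fun setT (fun x => Q (xsection W x)).
  exact: measurable_fun_xsection.
have /(ae_eq_integral_abs rho measurableT mQ) :
    (\int[rho]_x `|Q (xsection W x)| = 0)%E.
  by rewrite -[RHS]W0; apply: eq_integral => x _; rewrite gee0_abs.
apply: filterS => x /(_ I) Qx; exists (xsection W x); split=> //.
  exact: measurable_xsection.
by move=> v /= /contrapT; rewrite xsectionE.
Qed.

Lemma mnormalizeE d (T : measurableType d) (R : realType)
    (m : {measure set T -> \bar R}) (P : probability T R) (A : set T) :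
  m setT != 0%E -> m setT \is a fin_num ->
  mnormalize m P A = (m A * (fine (m setT))^-1%:E)%E.
Proof.
move=> m0; rewrite fin_numE => /andP[_ moo].
by rewrite /mnormalize (negbTE m0) (negbTE moo).
Qed.

(** * Ergodic theorem from uniqueness of the stationary measure *)

Section UniqueStationary.
Context dX dY (X : measurableType dX) (Y : measurableType dY) (R : realType).
Context (f : Y -> X -> X) (mu : probability Y R) (rho : probability X R).
Hypothesis mf : measurable_fun setT (fun z : Y * X => f z.1 z.2).
Hypothesis rho_st : stationary_under f mu rho.
(** Uniqueness is asked only among measures dominated by a multiple of [rho]; on the sphere these
    inherit regularity from [rho]. *)
Hypothesis rho_unique : forall nu : probability X R,
  (exists C : R, forall A, measurable A -> (nu A <= C%:E * rho A)%E) ->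
  stationary_under f mu nu -> forall A, measurable A -> nu A = rho A.
Context (Q : probability (sequences Y) R).
Hypothesis Q_law : product_law mu Q.
Local Notation skew := (skew f).
Local Notation m := (rho \x Q)%E.

(** If [m B] is positive, the marginal divided by [m B] is a stationary probability dominated by a
    multiple of [rho], hence equal to [rho]. *)
Lemma marginal_eq B A : measurable B -> skew @^-1` B = B -> measurable A ->
  m (B `&` (A `*` setT)) = ((fine (rho A))%:E * m B)%E.
Proof.
move=> mB skewB mA.
have mAT C : measurable C -> measurable (C `*` setT : set (X * sequences Y)).
  by move=> mC; exact: measurableX.
have [B0|B0] := eqVneq (m B) 0%E.
  rewrite B0 mule0; apply/eqP; rewrite -measure_le0 -B0.
  by rewrite le_measure ?inE//; apply: measurableI => //; exact: mAT.
have mB_fin : m B \is a fin_num.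
  by rewrite ge0_fin_numE// (le_lt_trans (probability_le1 m mB))// ltry.
(* The second argument [m] of [mnormalize] is only the default for mass zero or infinity, excluded
   here. *)
pose nu : probability X R := distribution (mnormalize (mrestr m mB) m)
  (mfun_pack (@measurable_fst _ _ X (sequences Y))).
have nuE C : nu C = (marginal rho Q B C * (fine (m B))^-1%:E)%E.
  transitivity (mnormalize (mrestr m mB) m (fst @^-1` C)); first by [].
  have restrT : mrestr m mB setT = m B by rewrite /mrestr setTI.
  rewrite mnormalizeE; last 2 first.
  - by rewrite [X in X != _]restrT.
  - by rewrite [X in X \is a _]restrT.
  rewrite [X in (_ * (fine X)^-1%:E)%E]restrT; congr (_ * _)%E.
  rewrite /mrestr /marginal setIC; congr (m (_ `&` _)).
  by apply/seteqP; split=> -[x v] //= [].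
have c0 : 0 < fine (m B).
  by apply: fine_gt0; rewrite lt0e B0 measure_ge0 ltey_eq mB_fin.
have nu_rho : nu A = rho A.
  apply: rho_unique => //.
    exists (fine (m B))^-1 => C mC; rewrite nuE muleC lee_wpmul2l//.
      by rewrite lee_fin invr_ge0 ltW.
    exact: marginal_le.
  move=> C mC; rewrite nuE (marginal_stationary mf rho_st Q_law mB skewB mC).
  have c1 : (0 <= (fine (m B))^-1%:E)%E by rewrite lee_fin invr_ge0 ltW.
  have mmarginal : measurable_fun setT (fun y => marginal rho Q B (f y @^-1` C)).
    (* [nu] is a genuine measure, so measurability of section measures is available for it. *)
    have numE D : marginal rho Q B D = (nu D * (fine (m B))%:E)%E.
      by rewrite nuE -muleA -EFinM mulVf ?gt_eqF// mule1.
    under eq_fun do rewrite numE.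
    apply: emeasurable_funM => //.
    have mfC : measurable ((fun z : Y * X => f z.1 z.2) @^-1` C).
      by rewrite -[X in measurable X]setTI; exact: mf.
    have := measurable_fun_xsection nu mfC.
    by congr measurable_fun; apply/funext => y /=; rewrite xsectionE.
  rewrite -(ge0_integralZr mu measurableT mmarginal)//.
  by apply: eq_integral => y _; rewrite -nuE.
rewrite fineK ?fin_num_measure// -nu_rho nuE -muleA -{2}(fineK mB_fin).
by rewrite -EFinM mulVf ?gt_eqF// mule1.
Qed.

(** For every [k], the excess of [A] over [rho A + 1/(k+1)] and that of its complement over
    [1 - rho A + 1/(k+1)] are almost surely bounded; countably many null sets are discarded. *)
Theorem frequency_ae A : measurable A ->
  {ae rho, forall x, {ae Q, forall v,
    (N%:R^-1 * \sum_(i < N) \1_A (iter i.+1 skew (x, v)).1 : R) @[N --> \oo]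
      --> fine (rho A)}}.
Proof.
move=> mA; pose AT : set (X * sequences Y) := A `*` setT.
have mAT : measurable AT by exact: measurableX.
have null C c : measurable C -> fine (rho C) < c ->
    m (unbounded_excess skew (C `*` setT) c) = 0%E.
  move=> mC Cc; have mCT : measurable (C `*` setT : set (X * sequences Y)).
    exact: measurableX.
  have c0 : 0 <= c by apply: le_trans (ltW Cc); exact: fine_ge0.
  apply: (@unbounded_excess_null _ _ _ (rho \x Q)%E skew _ c _ _ _ _ _ Cc)
    => //.
  - exact: measurable_skew.
  - by move=> W mW; exact: (skew_preserving mf rho_st Q_law mW).
  - apply: marginal_eq => //; last exact: unbounded_excess_invariant.
    by apply: measurable_unbounded_excess => //; exact: measurable_skew.
have munb C c : measurable C ->
    measurable (unbounded_excess skew (C `*` setT) c).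
  move=> mC; apply: measurable_unbounded_excess; first exact: measurable_skew.
  exact: measurableX.
have upper (k : nat) : {ae rho, forall x, {ae Q, forall v,
    ~ unbounded_excess skew AT (fine (rho A) + k.+1%:R^-1) (x, v)}}.
  apply: ae_sections; first exact: munb.
  by apply: null => //; rewrite ltrDl.
have ATC : ~` AT = (~` A) `*` setT.
  apply/seteqP; split=> -[x v] /=; first by move=> xA; split=> // Ax; apply: xA.
  by move=> [xA _] [].
have lower (k : nat) : {ae rho, forall x, {ae Q, forall v,
    ~ unbounded_excess skew (~` AT) (1 - fine (rho A) + k.+1%:R^-1) (x, v)}}.
  rewrite ATC; have mAC : measurable (~` A) by exact: measurableC.
  apply: ae_sections; first exact: munb.
  apply: null => //; rewrite probability_setC// fineB ?fin_num_measure//.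
  by rewrite ltrDl.
apply: filterS2 (ae_foralln upper) (ae_foralln lower) => x ux lx.
apply: filterS2 (ae_foralln ux) (ae_foralln lx) => v uv lv.
have := frequency_cvg uv lv; apply: cvg_trans; apply: near_eq_cvg.
near=> N; congr (_ * _); apply: eq_bigr => i _.
by rewrite !indicE in_setX in_setT andbT.
Unshelve. all: by end_near. Qed.
End UniqueStationary.

(** * Borel sets of the sphere, measurability of folding, regularity *)

Section SphereMeasurability.
Context {R : realType} {n : nat}.

Lemma measurable_sphere_coord (i : 'I_n.+1) :
  measurable_fun setT (fun x : sphere R n => sphere_val x 0 i).
Proof.
apply: (@measurability _ _ _ _ setT _ _ (@RGenOpens.measurableE R)).
move=> _ [_ [a [b ->]] <-]; rewrite setTI; apply: sub_sigma_algebra.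
exists [set v : 'rV[R]_n.+1 | `]a, b[%classic (v 0 i)] => //.
have /continuousP : continuous (fun v : 'rV[R]_n.+1 => v 0 i).
  exact: coord_continuous.
by apply; exact: itv_open.
Qed.

(** A base of the topology, indexed by a countable type. *)
Definition rational_box (p : {ffun 'I_n.+1 -> rat} * nat) : set 'rV[R]_n.+1 :=
  [set v | forall i, `|v 0 i - ratr (p.1 i)| < p.2.+1%:R^-1].

Lemma open_rational_boxes (V : set 'rV[R]_n.+1) : open V ->
  V = \bigcup_(p in [set p | rational_box p `<=` V]) rational_box p.
Proof.
move=> oV; apply/seteqP; split=> [v Vv|v [p pV /pV]//].
have /nbhs_ballP[e /= e0 ballV] : nbhs v V by exact: open_nbhs_nbhs.
have [k ke] : exists k : nat, k.+1%:R^-1 <= e / 2.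
  exists (Num.trunc (e / 2)^-1); rewrite invf_ple ?posrE ?divr_gt0//.
  by rewrite ltW// truncnS_gt.
have k0 : 0 < k.+1%:R^-1 :> R by rewrite invr_gt0.
(* A box around [q] containing [v] lies within [2/(k+1) <= e] of [v]. *)
have /choice[q vq] i : exists q : rat, `|v 0 i - ratr q| < k.+1%:R^-1.
  have /rat_in_itvoo[q] : v 0 i - k.+1%:R^-1 < v 0 i + k.+1%:R^-1.
    by rewrite ltrBlDr -addrA ltrDl addr_gt0.
  rewrite in_itv /= => /andP[q1 q2]; exists q; rewrite ltr_norml.
    by move: (k.+1%:R^-1) q1 q2 => r q1 q2; apply/andP; split; lra.
exists ([ffun i => q i], k); last by move=> i; rewrite ffunE.
move=> w /= wq; apply: ballV; split=> // i j; rewrite ord1 /ball /=.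
have := wq j; have := vq j; rewrite ffunE distrC => vj wj.
have -> : v 0 j - w 0 j = - (ratr (q j) - v 0 j) - (w 0 j - ratr (q j)).
  by ring.
rewrite (le_lt_trans (ler_normB _ _))// normrN.
rewrite (lt_le_trans (ltrD vj wj))//.
by have := ke; move: (k.+1%:R^-1) => r re; lra.
Qed.

(** Open sets of the sphere are traces of countable unions of rational boxes, and a box is a finite
    conjunction of conditions on coordinates. *)
Lemma measurable_into_sphere d (T : measurableType d) (f : T -> sphere R n) :
  (forall i, measurable_fun setT (fun t => sphere_val (f t) 0 i)) ->
  measurable_fun setT f.
Proof.
move=> mf; apply: (@measurability _ _ T (sphere R n) setT f _ erefl).
move=> _ [_ [V oV <-] <-]; rewrite setTI (open_rational_boxes oV).
rewrite !preimage_bigcup bigcup_mkcond.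
apply: countable_bigcupT_measurable => [|p].
  exact: countableP.
case: ifP => // _.
rewrite (_ : _ @^-1` _ = \bigcap_(i in [set: 'I_n.+1])
    [set t | `|sphere_val (f t) 0 i - ratr (p.1 i)| < p.2.+1%:R^-1]).
  apply: fin_bigcap_measurable => // i _; rewrite -[X in measurable X]setTI.
  apply: (@measurable_fun_ltr _ _ _ setT) => //.
  by apply: measurableT_comp => //; exact: measurable_funB.
by apply/seteqP; split=> t ft i => [_|]; exact: ft.
Qed.

Lemma measurable_fold :
  measurable_fun setT (fun z : sphere R n * sphere R n => fold z.1 z.2).
Proof.
pose dot (z : sphere R n * sphere R n) :=
  dotv (sphere_val z.2) (sphere_val z.1).
have mcoord (g : sphere R n * sphere R n -> sphere R n) i :
    measurable_fun setT g ->
    measurable_fun setT (fun z => sphere_val (g z) 0 i).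
  by move=> mg; exact: (measurableT_comp (measurable_sphere_coord i) mg).
have m1 i := mcoord _ i measurable_fst.
have m2 i := mcoord _ i measurable_snd.
have mdot : measurable_fun setT dot.
  by apply: measurable_sum => i; exact: measurable_funM.
apply: measurable_into_sphere => i.
rewrite (_ : (fun _ => _) = (fun z => if 0 < dot z then sphere_val z.2 0 i else
    sphere_val z.2 0 i - 2 * dot z * sphere_val z.1 0 i)).
  apply: measurable_fun_ifT => //.
  - exact: measurable_fun_ltr.
  - apply: measurable_funB => //; apply: measurable_funM => //.
    exact: measurable_funM.
apply/funext => z; rewrite /sphere_val /= /foldv /reflection -/(dot z).
by case: ifP => _ //; rewrite !mxE.
Qed.

Lemma sphere_hausdorff : hausdorff_space (sphere R n).
Proof.
rewrite open_hausdorff => x y xy.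
have : sphere_val x != sphere_val y by apply: contra_neq xy => /val_inj.
have := @norm_hausdorff R 'rV[R]_n.+1; rewrite open_hausdorff => /[apply].
move=> [[V W] /= [xV yW] [oV oW /eqP VW0]].
exists (sphere_val @^-1` V, sphere_val @^-1` W) => /=.
  by split; rewrite inE /=; [move: xV|move: yW]; rewrite inE.
split; [by exists V|by exists W|].
by rewrite -preimage_setI VW0 preimage_set0.
Qed.

Lemma open_measurable_sphere (O : set (sphere R n)) : open O -> measurable O.
Proof. by move=> oO; apply: sub_sigma_algebra. Qed.

Lemma compact_measurable_sphere (K : set (sphere R n)) :
  compact K -> measurable K.
Proof.
move=> /(compact_closed sphere_hausdorff) cK; rewrite -[K]setCK.
apply: measurableC; apply: open_measurable_sphere. exact: closed_openC.
Qed.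

(** An approximating set that misses [rho A] by less than [e / C] misses [nu A] by at most [e],
    since [nu] of the difference is at most [C] times its [rho]-measure. *)
Lemma regular_dominated (rho nu : probability (sphere R n) R) (C : R) :
  (forall A, measurable A -> (nu A <= C%:E * rho A)%E) ->
  regular rho -> regular nu.
Proof.
move=> nu_rho rho_reg A mA; have [rho_inf rho_sup] := rho_reg A mA.
have fin (P : probability (sphere R n) R) B : measurable B -> P B \is a fin_num.
  by move=> mB; exact: fin_num_measure.
(* Comparing the total masses makes [C] positive, so that [e / C] makes sense. *)
have C1 : 1 <= C.
  have := nu_rho _ measurableT; rewrite (@probability_setT _ _ _ nu).
  by rewrite (@probability_setT _ _ _ rho) mule1 lee_fin.
have C0 : 0 < C by rewrite (lt_le_trans _ C1).
have small e B D : measurable B -> measurable D -> B `<=` D ->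
    (rho D < rho B + (e / C)%:E -> nu D <= nu B + e%:E)%E.
  move=> mB mD BD rhoDB.
  have mDB : measurable (D `\` B) by exact: measurableD.
  have diff (P : probability (sphere R n) R) : (P D = P B + P (D `\` B))%E.
    by rewrite -measureU// ?setDIK// setDUK.
  move: rhoDB; rewrite !diff lteD2lE ?fin// => /ltW rhoDB.
  rewrite leeD2l// (le_trans (nu_rho _ mDB))//.
  have : (C%:E * rho (D `\` B) <= C%:E * (e / C)%:E)%E.
    by rewrite lee_pmul2l// lte_fin.
  by rewrite -EFinM mulrCA mulfV ?mulr1// gt_eqF.
split; apply/eqP; rewrite eq_le; apply/andP; split.
- apply: le_ereal_inf_tmp => _ [V [oV AV] <-].
  by rewrite le_measure ?inE//; exact: open_measurable_sphere.
- apply/lee_addgt0Pr => e e0.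
  have eC : 0 < e / C by rewrite divr_gt0.
  have : (rho A < rho A + (e / C)%:E)%E by rewrite lteDl ?fin// lte_fin.
  rewrite {1}rho_inf => /ereal_inf_lt[_ [V [oV AV] <-] rhoV].
  apply: (@le_trans _ _ (nu V)); first by apply: ereal_inf_lbound; exists V.
  by apply: small => //; exact: open_measurable_sphere.
- apply/lee_addgt0Pr => e e0.
  have eC : 0 < e / C by rewrite divr_gt0.
  have : (rho A - (e / C)%:E < rho A)%E.
    by rewrite lteBlDr// lteDl ?fin// lte_fin.
  rewrite [ltRHS]rho_sup => /ereal_sup_gt[_ [K [cK KA] <-]].
  rewrite lteBlDr// => rhoK.
  have mK := compact_measurable_sphere cK.
  apply: le_trans (small e K A mK mA KA rhoK) _.
  by rewrite leeD2r//; apply: ereal_sup_ubound; exists K.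
- apply: ge_ereal_sup => _ [K [cK KA] <-].
  by rewrite le_measure ?inE//; exact: compact_measurable_sphere.
Qed.

End SphereMeasurability.

(** * The law of the sequence of random directions *)

Section IidSequence.
Context d d' (Omega : measurableType d) (Y : measurableType d') (R : realType).
Context (P : probability Omega R) (mu : probability Y R).
Context (U : nat -> {RV P >-> Y}).

(** The shift by one makes the first direction [U 1] the coordinate 0. *)
Definition noise (w : Omega) : sequences Y := fun i => U i.+1 w.

Lemma measurable_noise : measurable_fun setT noise.
Proof. by apply: measurable_sequence => i; exact: measurable_funP. Qed.

Lemma iid_product_law : iid [set k | (1 <= k)%N] U mu ->
  product_law mu (distribution P (mfun_pack measurable_noise)).
Proof.
move=> [indep law] m B mB.
pose J := [fset (nat_of_ord i).+1 | i in 'I_m]%fset.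
(* Independence is used for the times 1 to [m]; the predecessor undoes the index shift of
   [noise]. *)
have := indep J (fun k => B k.-1); rewrite (_ : \bigcap_(i in _) _ =
    mfun_pack measurable_noise @^-1` box m B); last first.
  apply/seteqP; split=> w /=.
    move=> wB i im; apply: (wB i.+1) => /=.
    by apply/imfsetP; exists (Ordinal im).
  by move=> wB _ /= /imfsetP[i _ ->] /=; exact: wB.
move=> indepJ; apply: etrans (indepJ _ _) _ => //.
  by move=> _ /= /imfsetP[i _ ->].
rewrite big_imfset/=; last by move=> i j _ _ [] /val_inj.
rewrite [LHS]big_enum /=; apply: eq_bigr => i _.
by rewrite -(law i.+1).
Qed.

End IidSequence.

(** * The folding walk as an orbit of the skew product *)

Section FoldingWalk.
Context {R : realType} {n : nat}.
Implicit Types (u : nat -> sphere R n) (x : sphere R n).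

Lemma iter_skew_fold u x k :
  iter k (skew fold) (x, fun i => u i.+1) =
  (walk u x k, fun i => u (i + k).+1).
Proof.
elim: k => [|k IHk] /=; first by congr pair; apply/funext => i; rewrite addn0.
rewrite IHk /skew /=; congr pair.
by apply/funext => i; rewrite /shift_seq /= addSnnS.
Qed.

Lemma visits_sum u x (A : set (sphere R n)) N :
  (visits (walk u x) A N)%:R =
  \sum_(i < N) \1_A (iter i.+1 (skew fold) (x, fun i => u i.+1)).1 :> R.
Proof.
rewrite /visits -sum1_card natr_sum big_mkcond big_ord_recl.
(* The split-off term is time 0, which [visits] excludes. *)
rewrite [LHS]add0r.
apply: eq_bigr => i _; rewrite iter_skew_fold indicE.
by rewrite inE /= add0n; case: (_ \in A).
Qed.

End FoldingWalk.

Theorem corollary2 (R : realType) (n : nat)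
    (mu : probability (sphere R n) R) (G : set (sphere R n))
    (mu_regular : regular mu) (mu_support : is_support mu G)
    (C1 : halfspaces_cover G) (C2 : reflections_generate_dense G)
    (rho : probability (sphere R n) R)
    (rho_unique : is_unique_stationary mu rho)
    (d : measure_display) (Omega : measurableType d) (P : probability Omega R)
    (U : nat -> {RV P >-> sphere R n})
    (U_iid : iid [set k | (1 <= k)%N] U mu)
    (A : set (sphere R n)) (A_borel : measurable A) :
  {ae rho, forall x : sphere R n, {ae P, forall w : Omega,
    (fun N : nat => N%:R^-1 * (visits (walk (fun k => U k w) x) A N)%:R : R)
      @ \oo --> fine (rho A)}}.
Proof.
have [rho_reg rho_st rho_uniq] := rho_unique.
have unique (nu : probability (sphere R n) R) :
    (exists C : R, forall B, measurable B -> (nu B <= C%:E * rho B)%E) ->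
    stationary_under fold mu nu -> forall B, measurable B -> nu B = rho B.
  move=> [C nuC] nu_st; apply: rho_uniq => //.
  exact: (regular_dominated nuC).
have := frequency_ae measurable_fold rho_st unique (iid_product_law U_iid)
  A_borel.
apply: filterS => x [N [mN N0 sub]].
(* A null set for the law of the noise pulls back to a [P]-null set. *)
exists (noise U @^-1` N); split=> //.
  by rewrite -[X in measurable X]setTI; exact: measurable_noise.
move=> w nw; apply: sub => /= cvg; apply: nw.
apply: cvg_trans cvg; apply: near_eq_cvg; apply: nearW => K.
by rewrite visits_sum.
Qed.
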